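(* For every integer $k \geq 1$, $\mathrm{NTIME}(2^{kn}) \subseteq \textsc{Spec}_{2k+1}$.
   Context: For a positive integer $N$, $\mathsf{BINARY}(N)$ is its binary representation, and for $A\subseteq \mathbb{N}^+$, $\mathsf{BINARY}(A)$ is the set of binary representations of elements of $A$. $\mathrm{NTIME}(T(n))$ denotes the class of sets $A$ of positive integers such that $\mathsf{BINARY}(A)$ is accepted by a non-deterministic (possibly multi-tape) Turing machine in time $O(T(n))$, $n$ the input length. First-order sentences are over finite relational vocabularies, with equality. $\textsc{Spec}(\Phi)$ is the set of positive integers $n$ such that $\Phi$ has a model with universe of cardinality exactly $n$. $\textsc{Spec}_k$ is the class of all $\textsc{Spec}(\Phi)$ with $\Phi$ a first-order sentence using at most $k$ distinct variables (variables may be reused). *)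

(* Defs.v *)
From HB Require Import structures.
From mathcomp Require Import all_boot.
From mathcomp Require Import boolp classical_sets.

Set Implicit Arguments.
Unset Strict Implicit.
Unset Printing Implicit Defensive.

Local Open Scope classical_set_scope.

(* Most significant bit first, without leading zeros; meaningful for N > 0. *)
Definition BINARY (N : nat) : seq bool :=
  [seq odd (N %/ 2 ^ i) | i <- rev (iota 0 (trunc_log 2 N).+1)].

Inductive move := Left | Stay | Right.

Definition ord_of_move (m : move) : 'I_3 :=
  inord (match m with Left => 0 | Stay => 1 | Right => 2 end).

Definition move_of_ord (i : 'I_3) : move :=
  match val i with 0 => Left | 1 => Stay | _ => Right end.

Lemma ord_of_moveK : cancel ord_of_move move_of_ord.
Proof. by case; rewrite /move_of_ord /ord_of_move /= inordK. Qed.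

HB.instance Definition _ := Finite.copy move (can_type ord_of_moveK).

(* The machine has [ntm_tapes.+1] tapes; the input is written on tape 0.
   [ntm_trans q a] is the set of the possible (q', b, d): when in state q the
   symbols scanned are a, go to state q', write b and move the heads by d. *)
Record ntm := NTM {
  ntm_state : finType;
  ntm_symbol : finType;
  ntm_tapes : nat;
  ntm_blank : ntm_symbol;
  ntm_bit : bool -> ntm_symbol;
  ntm_bit_inj : injective ntm_bit;
  ntm_bit_blank : forall b, ntm_bit b != ntm_blank;
  ntm_start : ntm_state;
  ntm_accept : {set ntm_state};
  ntm_trans : ntm_state -> {ffun 'I_ntm_tapes.+1 -> ntm_symbol} ->
    {set ntm_state * {ffun 'I_ntm_tapes.+1 -> ntm_symbol}
                   * {ffun 'I_ntm_tapes.+1 -> move}}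
}.

(* Tapes are infinite to the right only, with cells numbered from 0. *)
Record config (M : ntm) := Config {
  cfg_state : ntm_state M;
  cfg_tape : 'I_(ntm_tapes M).+1 -> nat -> ntm_symbol M;
  cfg_head : 'I_(ntm_tapes M).+1 -> nat
}.

Definition init_config (M : ntm) (w : seq bool) : config M :=
  Config (ntm_start M)
    (fun j p => if j == ord0 then nth (ntm_blank M) (map (@ntm_bit M) w) p
                else ntm_blank M)
    (fun=> 0).

(* A head on the leftmost cell does not move when told to go left. *)
Definition move_head (d : move) (p : nat) : nat :=
  match d with Left => p.-1 | Stay => p | Right => p.+1 end.

Definition scanned (M : ntm) (c : config M) :
    {ffun 'I_(ntm_tapes M).+1 -> ntm_symbol M} :=
  [ffun j => cfg_tape c j (cfg_head c j)].

Definition next_config (M : ntm) (c : config M) (q : ntm_state M)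
    (b : {ffun 'I_(ntm_tapes M).+1 -> ntm_symbol M})
    (d : {ffun 'I_(ntm_tapes M).+1 -> move}) : config M :=
  Config q
    (fun j p => if p == cfg_head c j then b j else cfg_tape c j p)
    (fun j => move_head (d j) (cfg_head c j)).

Definition step (M : ntm) (c c' : config M) : Prop :=
  exists q b d, (q, b, d) \in ntm_trans (cfg_state c) (scanned c) /\
                c' = next_config c q b d.

Fixpoint reach (M : ntm) (t : nat) (c c' : config M) : Prop :=
  if t is t'.+1 then exists2 c1, step c c1 & reach t' c1 c' else c = c'.

(* Some computation on w is in an accepting state after exactly t steps. *)
Definition accepts_at (M : ntm) (w : seq bool) (t : nat) : Prop :=
  exists2 c, reach t (init_config M w) c & cfg_state c \in ntm_accept M.

Definition language (M : ntm) : set (seq bool) :=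
  [set w | exists t, accepts_at M w t].

(* Only the shortest accepting computation on each accepted input is timed;
   no bound is put on the other computations. *)
Definition runs_in_bigO (M : ntm) (T : nat -> nat) : Prop :=
  exists C n0, forall w, language M w -> n0 <= size w ->
    exists2 t, t <= C * T (size w) & accepts_at M w t.

Definition NTIME (T : nat -> nat) : set (set nat) :=
  [set A | A `<=` [set N | 0 < N] /\
           exists M : ntm, language M = BINARY @` A /\ runs_in_bigO M T].

Record vocabulary := Vocabulary {
  symbol : finType;
  arity : symbol -> nat;
  arity_gt0 : forall r, 0 < arity r
}.

Inductive formula (V : vocabulary) :=
| Eq of nat & nat
| Rel (r : symbol V) of (arity r).-tuple nat
| Not of formula V
| And of formula V & formula V
| Or of formula V & formula V
| Ex of nat & formula V
| All of nat & formula V.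

Fixpoint vars (V : vocabulary) (f : formula V) : seq nat :=
  match f with
  | Eq x y => [:: x; y]
  | Rel _ xs => xs
  | Not g => vars g
  | And g h | Or g h => vars g ++ vars h
  | Ex x g | All x g => x :: vars g
  end.

Fixpoint free_vars (V : vocabulary) (f : formula V) : seq nat :=
  match f with
  | Eq x y => [:: x; y]
  | Rel _ xs => xs
  | Not g => free_vars g
  | And g h | Or g h => free_vars g ++ free_vars h
  | Ex x g | All x g => [seq y <- free_vars g | y != x]
  end.

Definition sentence (V : vocabulary) (f : formula V) : Prop :=
  free_vars f = [::].

Definition num_vars (V : vocabulary) (f : formula V) : nat :=
  size (undup (vars f)).

Record structure (V : vocabulary) := Structure {
  universe : finType;
  interp : forall r : symbol V, {set (arity r).-tuple universe}
}.

Definition upd (T : Type) (e : nat -> T) (x : nat) (a : T) : nat -> T :=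
  fun y => if y == x then a else e y.

Fixpoint sat (V : vocabulary) (S : structure V) (e : nat -> universe S)
    (f : formula V) : Prop :=
  match f with
  | Eq x y => e x = e y
  | Rel r xs => map_tuple e xs \in interp S r
  | Not g => ~ sat e g
  | And g h => sat e g /\ sat e h
  | Or g h => sat e g \/ sat e h
  | Ex x g => exists a, sat (upd e x a) g
  | All x g => forall a, sat (upd e x a) g
  end.

(* Used for sentences, whose truth value does not depend on the assignment. *)
Definition models (V : vocabulary) (S : structure V) (f : formula V) : Prop :=
  forall e : nat -> universe S, sat e f.

Definition Spec (V : vocabulary) (f : formula V) : set nat :=
  [set n | 0 < n /\ exists S : structure V, #|universe S| = n /\ models S f].

Definition Spec_vars (k : nat) : set (set nat) :=
  [set A | exists (V : vocabulary) (f : formula V),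
             [/\ sentence f, num_vars f <= k & A = Spec f]].

(* Main.v *)
(* A computation of length L on BINARY N is a tiling of an L x L square, rows
   being times and columns being tape cells, subject to constraints on adjacent
   points only; that the input is BINARY N is checked by a binary counter that
   runs through the first N rows.  With L = D N^k, a point of the square is a
   pair of k-tuples of elements of the universe together with two numbers below
   the constant D, so that a tiling is a family of relations of arity 2k.
   Moving to an adjacent point increments a k-tuple lexicographically, and a
   single variable besides the 2k variables naming the point is enough for that:
   each digit is overwritten in place through this spare variable. *)
Require Import Defs.
From HB Require Import structures.
From mathcomp Require Import all_boot zify.
From mathcomp Require Import boolp classical_sets.

Set Implicit Arguments.
Unset Strict Implicit.
Unset Printing Implicit Defensive.

(** * First-order definability of tilings *)

(** Nondeterminism costs no variables: the interpretation of the relations guesses the computation,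
    and the sentence only checks it. The obstacle is that 2k variables already name one point, so
    two points can never be compared by name. Every condition therefore speaks of one point and of
    what is met after one move from it. The only absolute information is five flags (the four edges
    of the square and the low rows), each readable digit by digit with the spare variable. All the
    rest travels between neighbors: the instruction along its row, the heads to adjacent cells, the
    input up its columns. The bits of N are not given by the structure; but the low rows are those
    whose time has only its lowest digit nonzero, and not maximal, so that counting them in binary
    produces N. The linear order behind the digits is axiomatized in the same sentence. *)

Record tiles := Tiles {
  color : finType;
  color_flags : color -> bool * bool * bool * bool * bool;
  color_ok : pred color;
  vert : rel color;
  horiz : rel color
}.

(** Row T of the counter holds T + 1, so the counter is to be incremented in the rows T < N - 1 and
    reaches N in row N - 1. *)
Definition flags_at (N L T P : nat) :=
  (T == 0, T < N.-1, T.+1 == L, P == 0, P.+1 == L).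

Definition tiling (K : tiles) (N L : nat) (g : nat -> nat -> color K) : Prop :=
  [/\ forall T P, T < L -> P < L -> color_ok (g T P),
      forall T P, T < L -> P < L -> color_flags (g T P) = flags_at N L T P,
      forall T P, T.+1 < L -> P < L -> vert (g T P) (g T.+1 P) &
      forall T P, T < L -> P.+1 < L -> horiz (g T P) (g T P.+1)].

(** * Derived connectives, universal closure and counting of variables *)

Section Connectives.
Variable V : vocabulary.
Implicit Types (f g : formula V) (S : structure V).

Definition Tru : formula V := Eq V 0 0.
Definition Imp f g := Or (Not f) g.
Definition Iff f g := And (Imp f g) (Imp g f).
Definition AllIn (I : Type) (s : seq I) (F : I -> formula V) :=
  foldr (fun i f => And (F i) f) Tru s.
Definition ExIn (I : Type) (s : seq I) (F : I -> formula V) :=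
  Not (AllIn s (fun i => Not (F i))).
Definition Alls (xs : seq nat) f := foldr (@All V) f xs.
Definition Lit (b : bool) f := if b then f else Not f.

Lemma sat_And S (e : nat -> universe S) f g :
  sat e (And f g) <-> sat e f /\ sat e g.
Proof. by []. Qed.

Lemma sat_Imp S (e : nat -> universe S) f g :
  sat e (Imp f g) <-> (sat e f -> sat e g).
Proof.
rewrite /=; split=> [[nf|//] /nf//|fg].
by have [/fg|] := pselect (sat e f); [right|left].
Qed.

Lemma sat_Iff S (e : nat -> universe S) f g :
  sat e (Iff f g) <-> (sat e f <-> sat e g).
Proof.
split=> [[/sat_Imp ? /sat_Imp ?]|[? ?]]; first by split.
by split; apply/sat_Imp.
Qed.

Lemma sat_AllIn S (e : nat -> universe S) (I : eqType) (s : seq I) F :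
  sat e (AllIn s F) <-> forall i, i \in s -> sat e (F i).
Proof.
elim: s => [|i s IHs] /=; first by split.
split=> [[Fi /IHs Fs] j|Fs].
  by rewrite inE => /predU1P[->|/Fs].
split; first by apply: Fs; rewrite mem_head.
by apply/IHs => j js; apply: Fs; rewrite inE js orbT.
Qed.

Lemma sat_ExIn S (e : nat -> universe S) (I : eqType) (s : seq I) F :
  sat e (ExIn s F) <-> exists2 i, i \in s & sat e (F i).
Proof.
split=> [nA|[i si Fi] /sat_AllIn /(_ i si)//].
apply: contrapT => nE; apply: nA; apply/sat_AllIn => i si Fi.
by apply: nE; exists i.
Qed.

Lemma sat_Lit S (e : nat -> universe S) b f (c : bool) :
  (sat e f <-> c) -> (sat e (Lit b f) <-> b = c).
Proof.
by case: b; case: c => /= -[fc1 fc2]; split=> //;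
  [move/fc1|move=> /(_ (fc2 isT))|move=> _ /fc1].
Qed.

Lemma upd_id (T : Type) (e : nat -> T) x : upd e x (e x) = e.
Proof. by apply/funext => y; rewrite /upd; case: eqP => // ->. Qed.

(** As [models] ranges over all assignments, the closing quantifiers add nothing: instantiating one
    at the current value of its variable leaves the assignment unchanged. *)
Lemma models_Alls S xs f :
  models S (Alls xs f) <-> forall e : nat -> universe S, sat e f.
Proof.
elim: xs => [//|x xs IHxs]; rewrite -IHxs /models /=.
by split=> [h e|h e a//]; rewrite -(upd_id e x); apply: h.
Qed.

Lemma free_vars_sub f : {subset free_vars f <= vars f}.
Proof.
elim: f => [x1 x2|r xs|f IHf|f IHf g IHg|f IHf g IHg|x f IHf|x f IHf] y //=;
  rewrite ?mem_cat ?mem_filter ?inE //; first exact: IHf.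
- by case/orP=> [/IHf|/IHg] ->; rewrite ?orbT.
- by case/orP=> [/IHf|/IHg] ->; rewrite ?orbT.
- by case/andP=> _ /IHf ->; rewrite orbT.
- by case/andP=> _ /IHf ->; rewrite orbT.
Qed.

Lemma free_vars_Alls xs f :
  free_vars (Alls xs f) = [seq y <- free_vars f | y \notin xs].
Proof.
elim: xs => [|x xs IHxs] /=; first by rewrite filter_predT.
rewrite IHxs -filter_predI; apply: eq_filter => y /=.
by rewrite inE negb_or.
Qed.

Definition below n f := all (fun x => x < n) (vars f).

Lemma below_AllIn n (I : Type) (s : seq I) F :
  0 < n -> (forall i, below n (F i)) -> below n (AllIn s F).
Proof.
move=> n0 HF; elim: s => [|i s IHs]; first by rewrite /below /= n0.
by rewrite /below /= all_cat; apply/andP; split; [apply: HF|apply: IHs].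
Qed.

Lemma below_ExIn n (I : Type) (s : seq I) F :
  0 < n -> (forall i, below n (F i)) -> below n (ExIn s F).
Proof. by move=> n0 HF; apply: (@below_AllIn n I s (fun i => Not (F i))). Qed.

(** Bounding the indices replaces counting distinct variables: all reuse takes place among the n
    variables that the closure binds. *)
Lemma below_Alls n f : below n f ->
  sentence (Alls (iota 0 n) f) /\ num_vars (Alls (iota 0 n) f) <= n.
Proof.
move=> /allP fn; split.
  rewrite /sentence free_vars_Alls; apply/eqP; rewrite -[_ == _]negbK -has_filter.
  by apply/hasPn => x /free_vars_sub /fn xn; rewrite mem_iota negbK.
have vn : vars (Alls (iota 0 n) f) = iota 0 n ++ vars f.
  by elim: (iota 0 n) => //= x s ->.
rewrite /num_vars vn -[leqRHS](size_iota 0); apply: uniq_leq_size (undup_uniq _) _ => x.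
by rewrite mem_undup mem_cat orbC => /orP[/fn|//]; rewrite mem_iota.
Qed.

End Connectives.

(** * Numbers split into a low digit and a high part *)

Lemma digit_lt n a b c : a < n -> b < c -> a + n * b < n * c.
Proof.
move=> an bc; apply: (@leq_trans (n * b.+1)); last by rewrite leq_mul2l bc orbT.
by rewrite mulnS -addSn leq_add2r.
Qed.

Lemma digit_last n a b c : a < n -> b < c ->
  ((a + n * b).+1 == n * c) = (a.+1 == n) && (b.+1 == c).
Proof.
move=> an bc; apply/eqP/andP => [abc|[/eqP a1 /eqP <-]]; last first.
  by rewrite mulnS -addSn a1.
have bc1 : b.+1 = c.
  apply/eqP; rewrite eqn_leq bc leqNgt; apply/negP => bc2.
  by have := digit_lt an bc2; rewrite -abc mulnS; lia.
by split; apply/eqP => //; move: abc; rewrite -bc1 mulnS; lia.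
Qed.

(** Makes the low rows definable by [Low], digit by digit, without comparing tuples. *)
Lemma digit_low n a b : a < n -> (a + n * b < n.-1) = (a.+1 != n) && (b == 0).
Proof.
move=> an; case: b => [|b]; first by rewrite muln0 andbT; lia.
by rewrite andbF mulnS; move: (n * b) => c; lia.
Qed.

(** * Ranks in a finite strict linear order *)

Section Rank.
Variables (U : finType) (lt : rel U).
Hypothesis lt_irr : irreflexive lt.
Hypothesis lt_trans : transitive lt.
Hypothesis lt_total : forall x y, [\/ x = y, lt x y | lt y x].

Definition rank x := #|[set y | lt y x]|.

Lemma rank_mono x y : lt x y -> rank x < rank y.
Proof.
move=> xy; apply/proper_card/properP; split.
  by apply/fintype.subsetP => z; rewrite !inE => /lt_trans; apply.
by exists x; rewrite !inE ?lt_irr.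
Qed.

Lemma rank_lt x : rank x < #|U|.
Proof.
rewrite -cardsT; apply/proper_card/properP; split; first exact: finset.subsetT.
by exists x; rewrite !inE ?lt_irr.
Qed.

Lemma lt_rank x y : lt x y = (rank x < rank y).
Proof.
apply/idP/idP => [/rank_mono//|]; case: (lt_total x y) => [->|//|/rank_mono].
  by rewrite ltnn.
by move=> yx /(ltn_trans yx); rewrite ltnn.
Qed.

Lemma rank_inj : injective rank.
Proof. by move=> x y xy; case: (lt_total x y) => //; rewrite lt_rank xy ltnn. Qed.

End Rank.

Definition digits_val (U : finType) (rk : U -> nat) (s : seq U) :=
  foldr (fun x v => rk x + #|U| * v) 0 s.

(** * The sentence whose models are tilings *)

Section Grid.
Variables (K : tiles) (k d : nat).
Hypothesis k_gt0 : 0 < k.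
Local Notation D := d.+1.

Definition grid_symbol : finType := (bool + 'I_D * 'I_D * color K)%type.
Definition grid_arity (r : grid_symbol) := if r is inl _ then 2 else 2 * k.

Fact grid_arity_gt0 r : 0 < grid_arity r.
Proof. by case: r => //= _; rewrite muln_gt0. Qed.

Definition grid_voc := Vocabulary grid_arity_gt0.
Local Notation formula := (formula grid_voc).

Definition Lt (x y : nat) : formula := @Rel grid_voc (inl true) [tuple x; y].
(** Successor is definable from [Lt], but only with a third variable, and inside [Inc] all variables
    besides x and the spare one hold digits to be kept. Hence a primitive symbol, tied to [Lt] by
    [Order]. *)
Definition Su (x y : nat) : formula := @Rel grid_voc (inl false) [tuple x; y].
(** The arguments are always the same variables in the same order: another point is reached by
    changing their values. *)
Definition Lab (r s : nat) (c : color K) : formula :=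
  @Rel grid_voc (inr (inord r, inord s, c)) (iota_tuple (2 * k) 0).

Definition tvars := iota 0 k.
Definition pvars := iota k k.
Definition spare := 2 * k.

Definition Min x : formula := Not (Ex spare (Lt spare x)).
Definition Max x : formula := Not (Ex spare (Lt x spare)).

(* Tuples of variables are read as numbers in base N, least significant
   digit first.  The value of a digit is moved through the spare variable, so
   that a digit can be incremented in place. *)
Fixpoint Inc (xs : seq nat) (f g : formula) : formula :=
  if xs is x :: xs' then
    Or (Ex spare (And (Su x spare) (Ex x (And (Eq _ x spare) f))))
       (And (Max x) (Ex x (And (Min x) (Inc xs' f g))))
  else g.

(** Under the universal closure, 0, 1 and 2 stand here for arbitrary elements rather than digits.
    Three variables are available because 2k + 1 >= 3. *)
Definition Order : formula :=
  And (Not (Lt 0 0))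
  (And (Imp (And (Lt 0 1) (Lt 1 2)) (Lt 0 2))
  (And (Or (Eq _ 0 1) (Or (Lt 0 1) (Lt 1 0)))
       (Iff (Su 0 1) (And (Lt 0 1) (Not (Ex 2 (And (Lt 0 2) (Lt 2 1)))))))).

Definition Zero (r : nat) xs : formula :=
  if r == 0 then AllIn xs Min else Not (Tru _).
Definition Last (r : nat) xs : formula :=
  if r == d then AllIn xs Max else Not (Tru _).
Definition Low (r : nat) xs : formula :=
  And (Not (Max (head 0 xs))) (Zero r (behead xs)).

(** The guard makes the constraint void outside the square, where [inord] would send the index D to
    0. *)
Definition NoLab (bad : pred (color K)) r s : formula :=
  if (r < D) && (s < D) then
    AllIn (enum bad) (fun c => Not (Lab r s c))
  else Tru _.

Definition Flags r s (c : color K) : formula :=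
  let: (b1, b2, b3, b4, b5) := color_flags c in
  And (Lit b1 (Zero r tvars))
  (And (Lit b2 (Low r tvars))
  (And (Lit b3 (Last r tvars))
  (And (Lit b4 (Zero s pvars))
       (Lit b5 (Last s pvars))))).

(** Uniqueness of the color is not imposed. Every label of a point must be compatible with every
    label of the next ones, so any choice of admissible labels is a tiling. *)
Definition Point r s : formula :=
  And (ExIn (enum (@color_ok K)) (Lab r s))
  (AllIn (enum (color K)) (fun c => Imp (Lab r s c)
    (And (Flags r s c)
    (And (Inc tvars (NoLab (predC (vert c)) r s) (NoLab (predC (vert c)) r.+1 s))
         (Inc pvars (NoLab (predC (horiz c)) r s)
                    (NoLab (predC (horiz c)) r s.+1)))))).

Definition Matrix : formula :=
  And Order (AllIn (iota 0 D) (fun r => AllIn (iota 0 D) (Point r))).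

Definition Grid : formula := Alls (iota 0 (2 * k + 1)) Matrix.

Lemma below_Inc xs f g : all (fun x => x < 2 * k + 1) xs ->
  below (2 * k + 1) f -> below (2 * k + 1) g -> below (2 * k + 1) (Inc xs f g).
Proof.
move=> + bf bg; elim: xs => [//|x xs IHxs] /= /andP[xk /IHxs].
rewrite /below /= !all_cat /= => ->; rewrite -/(below _ f) bf xk /spare.
by rewrite addn1 ltnSn.
Qed.

Lemma below_Matrix : below (2 * k + 1) Matrix.
Proof.
have n0 : 0 < 2 * k + 1 by lia.
have bMin x : x < 2 * k + 1 -> below (2 * k + 1) (Min x).
  by move=> xk; rewrite /below /= xk /spare addn1 ltnSn.
have bMax x : x < 2 * k + 1 -> below (2 * k + 1) (Max x).
  by move=> xk; rewrite /below /= xk /spare addn1 ltnSn.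
have bTru : below (2 * k + 1) (Tru grid_voc) by rewrite /below /= n0.
have bAnd f g : below (2 * k + 1) f -> below (2 * k + 1) g ->
    below (2 * k + 1) (And f g).
  by rewrite /below /= all_cat => -> ->.
have bImp f g : below (2 * k + 1) f -> below (2 * k + 1) g ->
    below (2 * k + 1) (Imp f g).
  by rewrite /below /= all_cat => -> ->.
have bLab r s c : below (2 * k + 1) (Lab r s c).
  by apply/allP => x; rewrite /= mem_iota; lia.
have bNoLab p r s : below (2 * k + 1) (NoLab p r s).
  by rewrite /NoLab; case: ifP => // _; apply: below_AllIn => // c; apply: bLab.
have bAll xs (F : nat -> formula) : all (fun x => x < 2 * k + 1) xs ->
    (forall x, x < 2 * k + 1 -> below (2 * k + 1) (F x)) ->
    below (2 * k + 1) (AllIn xs F).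
  move=> + HF; elim: xs => [_|x xs IHxs]; first exact: bTru.
  by case/andP=> /HF bx /IHxs bs; apply: (bAnd).
have bt : all (fun x => x < 2 * k + 1) tvars.
  by apply/allP => x; rewrite mem_iota; lia.
have bp : all (fun x => x < 2 * k + 1) pvars.
  by apply/allP => x; rewrite mem_iota; lia.
have bZero r xs : all (fun x => x < 2 * k + 1) xs ->
    below (2 * k + 1) (Zero r xs).
  by move=> bx; rewrite /Zero; case: ifP => // _; apply: bAll.
have bLast r xs : all (fun x => x < 2 * k + 1) xs ->
    below (2 * k + 1) (Last r xs).
  by move=> bx; rewrite /Last; case: ifP => // _; apply: bAll.
have bLit b f : below (2 * k + 1) f -> below (2 * k + 1) (Lit b f) by case: b.
apply: (bAnd _ _); first by rewrite /below /=; lia.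
apply: below_AllIn => // r; apply: below_AllIn => // s.
apply: (bAnd _ _); first exact: below_ExIn.
apply: below_AllIn => // c; apply: bImp => //.
apply: (bAnd); last by apply: (bAnd); apply: below_Inc.
have bLow r0 xs : all (fun x => x < 2 * k + 1) xs -> head 0 xs < 2 * k + 1 ->
    below (2 * k + 1) (Low r0 xs).
  move=> bxs xk; apply: (bAnd); first exact: bMax.
  by apply: bZero; case: xs bxs {xk} => //= ? ? /andP[].
rewrite /Flags; case: color_flags => [[[[b1 b2] b3] b4] b5].
have t0 : head 0 tvars < 2 * k + 1 by rewrite /tvars; case: (k).
by do 4?[apply: (bAnd); first by apply: bLit; auto]; apply: bLit; auto.
Qed.

Lemma Grid_sentence : sentence Grid /\ num_vars Grid <= 2 * k + 1.
Proof. exact: below_Alls below_Matrix. Qed.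


(** * Meaning of the formulas under any numbering [rk] of the universe that fits the order *)

Section Semantics.
Variables (S : structure grid_voc) (rk : universe S -> nat).
Local Notation U := (universe S).
Local Notation N := #|universe S|.
Implicit Types (e : nat -> U) (xs : seq nat) (f g : formula).

Hypothesis rk_lt : forall x, rk x < N.
Hypothesis rk_inj : injective rk.
Hypothesis Lt_rk : forall x y : U,
  ([tuple x; y] \in interp S (inl true : symbol grid_voc)) = (rk x < rk y).
Hypothesis Su_rk : forall x y : U,
  ([tuple x; y] \in interp S (inl false : symbol grid_voc)) = (rk y == (rk x).+1).

Lemma rk_surj n : n < N -> exists x, rk x = n.
Proof.
move=> nN; pose h x := Ordinal (rk_lt x).
have h_inj : injective h by move=> x y /(congr1 val) /rk_inj.
have [h' hK h'K] := inj_card_bij h_inj (eq_leq (card_ord N)).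
by exists (h' (Ordinal nN)); rewrite -[LHS]/(val (h _)) h'K.
Qed.

Lemma sat_Lt e x y : sat e (Lt x y) <-> rk (e x) < rk (e y).
Proof.
rewrite /= -Lt_rk; set t := map_tuple _ _.
by have -> : t = [tuple e x; e y] by apply: val_inj.
Qed.

Lemma sat_Su e x y : sat e (Su x y) <-> rk (e y) = (rk (e x)).+1.
Proof.
rewrite /= (rwP eqP) -Su_rk; set t := map_tuple _ _.
by have -> : t = [tuple e x; e y] by apply: val_inj.
Qed.

Lemma sat_Min e x : x != spare -> sat e (Min x) <-> rk (e x) == 0.
Proof.
move=> xz; split=> [nz|/eqP x0 [a /sat_Lt]]; last first.
  by rewrite /upd eqxx (negPf xz) x0.
apply: contrapT => /negP; rewrite -lt0n => x0; apply: nz.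
have [a a0] := rk_surj (ltn_trans x0 (rk_lt (e x))).
by exists a; apply/sat_Lt; rewrite /upd eqxx (negPf xz) a0.
Qed.

Lemma sat_Max e x : x != spare -> sat e (Max x) <-> (rk (e x)).+1 == N.
Proof.
move=> xz; split=> [nz|/eqP xN [a /sat_Lt]]; last first.
  by rewrite /upd eqxx (negPf xz) -[_ < _]/(_.+1 <= _) xN leqNgt rk_lt.
apply: contrapT => /negP xN; apply: nz.
have [a ax] : exists a, rk a = (rk (e x)).+1.
  by apply: rk_surj; rewrite ltn_neqAle xN rk_lt.
by exists a; apply/sat_Lt; rewrite /upd eqxx (negPf xz) ax.
Qed.

Lemma sat_Order e : sat e Order.
Proof.
split; first by move/sat_Lt; rewrite ltnn.
split; first by apply/sat_Imp => -[/sat_Lt xy /sat_Lt yz]; apply/sat_Lt; lia.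
split.
  have [xy|yx|/rk_inj] := ltngtP (rk (e 0)) (rk (e 1)).
  - by right; left; apply/sat_Lt.
  - by right; right; apply/sat_Lt.
  - by left.
apply/sat_Iff; rewrite sat_Su; split=> [xy|[/sat_Lt xy nz]].
  split; first by apply/sat_Lt; rewrite xy.
  by case=> z [/sat_Lt + /sat_Lt]; rewrite /upd /= xy; lia.
apply: contrapT => yx; have lt_xy : (rk (e 0)).+1 < rk (e 1) by lia.
have [z zx] := rk_surj (ltn_trans lt_xy (rk_lt _)).
by apply: nz; exists z; split; apply/sat_Lt; rewrite /upd /=; lia.
Qed.

Local Notation num := (digits_val rk).

Lemma num_lt s : num s < N ^ size s.
Proof.
elim: s => [//|x s IHs] /=; by rewrite expnS; apply: digit_lt.
Qed.

Lemma num_inj s t : size s = size t -> num s = num t -> s = t.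
Proof.
elim: s t => [[]//|x s IHs] [//|y t] /= [/IHs{}IHs] e.
have N0 : 0 < N := leq_ltn_trans (leq0n _) (rk_lt x).
have xy : rk x = rk y.
  by have := congr1 (modn^~ N) e; rewrite ![_ + N * _]addnC ![N * _]mulnC !modnMDl !modn_small.
rewrite (rk_inj xy) IHs //; apply/eqP; rewrite -(eqn_pmul2l N0).
by move: e; rewrite xy => /addnI ->.
Qed.

Lemma num_surj m v : v < N ^ m -> exists2 s, size s = m & num s = v.
Proof.
elim: m v => [|m IHm] v; first by case: v => // _; exists [::].
rewrite expnS => vN; have N0 : 0 < N by case: (N) vN.
have [x xv] := rk_surj (ltn_pmod v N0).
have [|s <- sv] := IHm (v %/ N); first by rewrite ltn_divLR // mulnC.
by exists (x :: s) => //=; rewrite xv sv addnC mulnC -divn_eq.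
Qed.

Lemma eq_num e e' xs : {in xs, e =1 e'} -> num (map e xs) = num (map e' xs).
Proof. by move/eq_in_map => ->. Qed.

(** [F] and [G] vary in the induction: after a carry the digit x is 0 and the remaining digits count
    N times more, so [F] becomes [fun v => F (N * v)]. The assumptions on f and g cover every
    assignment agreeing with e off [spare :: xs], so whatever is left in the spare variable does no
    harm. *)
Lemma sat_Inc xs f g e (F G : nat -> Prop) :
  uniq (spare :: xs) ->
  (forall e', (forall y, y \notin spare :: xs -> e' y = e y) ->
     sat e' f <-> F (num (map e' xs))) ->
  (forall e', (forall y, y \notin spare :: xs -> e' y = e y) ->
     sat e' g <-> G (num (map e' xs))) ->
  sat e (Inc xs f g) <->
  let v := (num (map e xs)).+1 in if v < N ^ size xs then F v else G 0.
Proof.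
elim: xs e F G => [|x xs IHxs] e F G /=; first by move=> _ _ /(_ e)->.
rewrite inE negb_or -andbA => /and4P[zx zxs xxs uxs] fF gG.
have xz : x != spare by rewrite eq_sym.
have N0 : 0 < N := leq_ltn_trans (leq0n _) (rk_lt (e x)).
have updS a b y : y \notin [:: spare, x & xs] -> upd (upd e spare a) x b y = e y.
  by rewrite !inE !negb_or /upd => /and3P[/negPf-> /negPf->].
have updX a : {in xs, upd e x a =1 e}.
  by move=> y yxs; rewrite /upd; case: eqP yxs xxs => // -> ->.
have updZ a b : {in xs, upd (upd e spare a) x b =1 e}.
  move=> y yxs; rewrite /upd; case: eqP yxs xxs => [-> ->//|_ yxs _].
  by case: eqP yxs zxs => // -> ->.
have vlt := num_lt (map e xs); rewrite size_map in vlt.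
have updx (T : Type) (e1 : nat -> T) a : upd e1 x a x = a by rewrite /upd eqxx.
have carry a : rk a = 0 -> sat (upd e x a) (Inc xs f g) <->
    let v := (num (map e xs)).+1 in if v < N ^ size xs then F (N * v) else G 0.
  move=> a0; rewrite (IHxs _ (fun v => F (N * v)) (fun v => G (N * v))) /=.
  - by rewrite (eq_num (updX a)) muln0.
  - by rewrite zxs.
  - move=> e' e'E; rewrite fF /=; first by rewrite e'E ?inE ?negb_or ?xz // updx a0.
    move=> y; rewrite !inE !negb_or => /and3P[yz yx yxs].
    by rewrite e'E ?inE ?negb_or ?yz // /upd (negPf yx).
  - move=> e' e'E; rewrite gG /=; first by rewrite e'E ?inE ?negb_or ?xz // updx a0.
    move=> y; rewrite !inE !negb_or => /and3P[yz yx yxs].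
    by rewrite e'E ?inE ?negb_or ?yz // /upd (negPf yx).
have [xN|xN] := eqVneq (rk (e x)).+1 N.
  have -> : (rk (e x) + N * num (map e xs)).+1 = N * (num (map e xs)).+1 by lia.
  rewrite expnS ltn_pmul2l //; split=> [[[a [/sat_Su]]|[_ [a [/(sat_Min _ xz) + /carry]]]]|].
  - by rewrite /upd eqxx (negPf xz) => ax; have := rk_lt a; lia.
  - by rewrite updx => /eqP a0 /(_ a0).
  - move=> h; right; split; first by apply/(sat_Max _ xz); rewrite xN.
    have [a a0] := rk_surj N0; exists a; split; last exact/carry.
    by apply/(sat_Min _ xz); rewrite updx a0.
have ltN : (rk (e x)).+1 < N by rewrite ltn_neqAle xN rk_lt.
have -> : (rk (e x) + N * num (map e xs)).+1 < N ^ (size xs).+1.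
  by rewrite expnS -addSn; apply: digit_lt.
have step a b : rk b = (rk (e x)).+1 ->
    sat (upd (upd e spare a) x b) f <-> F (rk (e x) + N * num (map e xs)).+1.
  by move=> bx; rewrite fF; [rewrite /= updx (eq_num (updZ a b)) bx | apply: updS].
split=> [[[a [/sat_Su ax [b [ba fb]]]]|[/(sat_Max _ xz)]]|Fv].
- apply/(step a b) => //; move: ba ax.
  by rewrite /= /upd !eqxx (negPf xz) (negPf zx) => ->.
- by rewrite (negPf xN).
- have [a ax] := rk_surj ltN; left; exists a; split.
    by apply/sat_Su; rewrite /upd eqxx (negPf xz).
  exists a; split; last exact/step.
  by rewrite /= /upd !eqxx (negPf zx).
Qed.


Local Notation M := (N ^ k).
Local Notation L := (D * M).

Definition tnum e := num (map e tvars).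
Definition pnum e := num (map e pvars).

Lemma tnum_lt e : tnum e < M.
Proof. by have := num_lt (map e tvars); rewrite size_map size_iota. Qed.

Lemma pnum_lt e : pnum e < M.
Proof. by have := num_lt (map e pvars); rewrite size_map size_iota. Qed.

(* The point (T, P) of the square is given by T = r M + t and P = s M + p, where
   r and s are numbers below D and t and p are the values of the tuples of
   variables tvars and pvars. *)
Definition lab (c : color K) (T P : nat) : Prop :=
  exists2 u : (2 * k).-tuple U,
    u \in interp S (inr (inord (T %/ M), inord (P %/ M), c) : symbol grid_voc) &
    num (take k u) = T %% M /\ num (drop k u) = P %% M.

Definition represents r s f (C : nat -> nat -> Prop) :=
  forall e, sat e f <-> C (r * M + tnum e) (s * M + pnum e).

Lemma vars_cat : iota 0 (2 * k) = tvars ++ pvars.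
Proof. by rewrite /tvars /pvars -iotaD addnn mul2n. Qed.

Lemma represents_Lab r s c : represents r s (Lab r s c) (lab c).
Proof.
move=> e; have M0 : 0 < M := leq_ltn_trans (leq0n _) (tnum_lt e).
rewrite /lab !divnMDl // !modnMDl !(divn_small (tnum_lt e), divn_small (pnum_lt e)).
rewrite !(modn_small (tnum_lt e), modn_small (pnum_lt e)) !addn0 /=.
set t := map_tuple _ _.
have tE : tval t = map e tvars ++ map e pvars by rewrite -map_cat -vars_cat.
have st : size (map e tvars) = k by rewrite size_map size_iota.
have sp : size (map e pvars) = k by rewrite size_map size_iota.
split=> [tS|[u uS [tu pu]]].
  exists t => //; rewrite tE take_size_cat // drop_size_cat //.
suff -> : t = u by [].
apply: val_inj; rewrite [LHS]tE -[RHS](cat_take_drop k); congr (_ ++ _).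
- by apply: num_inj; rewrite ?tu // st size_take size_tuple; case: ltnP; lia.
- by apply: num_inj; rewrite ?pu // sp size_drop size_tuple; lia.
Qed.

Lemma tvarsP x : (x \in tvars) = (x < k).
Proof. by rewrite mem_iota. Qed.

Lemma pvarsP x : (x \in pvars) = (k <= x < 2 * k).
Proof. by rewrite mem_iota addnn mul2n. Qed.

(** A carry out of the k digits leaves them all 0 and turns r into r + 1; this is the case handled
    by g, a different formula since r is not a variable. *)
Lemma represents_Inc_t r s f g C : represents r s f C -> represents r.+1 s g C ->
  represents r s (Inc tvars f g) (fun T P => C T.+1 P).
Proof.
move=> fC gC e; pose H r v := C (r * M + v) (s * M + pnum e).
have eqp e' : (forall y, y \notin spare :: tvars -> e' y = e y) -> pnum e' = pnum e.
  move=> e'E; apply: eq_num => x; rewrite pvarsP => xp; apply: e'E.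
  by rewrite inE tvarsP /spare; lia.
rewrite (sat_Inc (F := H r) (G := H r.+1)).
- have := tnum_lt e; rewrite /H /= -/(tnum e) size_iota => tM.
  case: ltnP => [_|Mt]; first by rewrite addnS.
  by rewrite -addnS (eqP (_ : (tnum e).+1 == M)) ?mulSnr ?addn0 // eqn_leq tM Mt.
- by rewrite cons_uniq iota_uniq tvarsP /spare; lia.
- by move=> e' /eqp ee; rewrite fC ee.
- by move=> e' /eqp ee; rewrite gC ee.
Qed.

Lemma represents_Inc_p r s f g C : represents r s f C -> represents r s.+1 g C ->
  represents r s (Inc pvars f g) (fun T P => C T P.+1).
Proof.
move=> fC gC e; pose H s v := C (r * M + tnum e) (s * M + v).
have eqt e' : (forall y, y \notin spare :: pvars -> e' y = e y) -> tnum e' = tnum e.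
  move=> e'E; apply: eq_num => x; rewrite tvarsP => xp; apply: e'E.
  by rewrite inE pvarsP /spare; lia.
rewrite (sat_Inc (F := H s) (G := H s.+1)).
- have := pnum_lt e; rewrite /H /= -/(pnum e) size_iota => tM.
  case: ltnP => [_|Mt]; first by rewrite addnS.
  by rewrite -addnS (eqP (_ : (pnum e).+1 == M)) ?mulSnr ?addn0 // eqn_leq tM Mt.
- by rewrite cons_uniq iota_uniq pvarsP /spare; lia.
- by move=> e' /eqt ee; rewrite fC ee.
- by move=> e' /eqt ee; rewrite gC ee.
Qed.

Lemma represents_NoLab bad r s : represents r s (NoLab bad r s)
  (fun T P => T < L -> P < L -> forall c, bad c -> ~ lab c T P).
Proof.
move=> e; rewrite /NoLab; have [tM pM] := (tnum_lt e, pnum_lt e).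
have lt_L a b : b < M -> (a * M + b < L) = (a < D).
  by move=> bM; rewrite -ltn_divLR ?divnMDl ?(divn_small bM) ?addn0; lia.
rewrite !lt_L //; case: (ltnP r D); case: (ltnP s D) => //=.
rewrite sat_AllIn => _ _; split=> [h _ _ c bc /represents_Lab|h c].
  by apply: h; rewrite mem_enum.
by rewrite mem_enum => bc /represents_Lab; apply: h.
Qed.

Lemma sat_Mins e xs : spare \notin xs ->
  sat e (AllIn xs Min) <-> num (map e xs) == 0.
Proof.
move=> zxs; rewrite sat_AllIn.
have xsz x : x \in xs -> x != spare by apply: contraTneq => ->.
have N0 : 0 < N := leq_ltn_trans (leq0n _) (rk_lt (e 0)).
suff -> : (num (map e xs) == 0) = all (fun x => rk (e x) == 0) xs.
  split=> [h|/allP h x xxs]; last by apply/(sat_Min _ (xsz _ xxs))/h.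
  by apply/allP => x xxs; apply/(sat_Min _ (xsz _ xxs))/h.
elim: xs {zxs xsz} => //= x xs <-.
by rewrite addn_eq0 muln_eq0 (gtn_eqF N0).
Qed.

Lemma sat_Maxs e xs : spare \notin xs ->
  sat e (AllIn xs Max) <-> (num (map e xs)).+1 == N ^ size xs.
Proof.
move=> zxs; rewrite sat_AllIn.
have xsz x : x \in xs -> x != spare by apply: contraTneq => ->.
have N0 : 0 < N := leq_ltn_trans (leq0n _) (rk_lt (e 0)).
suff -> : ((num (map e xs)).+1 == N ^ size xs) =
    all (fun x => (rk (e x)).+1 == N) xs.
  split=> [h|/allP h x xxs]; last by apply/(sat_Max _ (xsz _ xxs))/h.
  by apply/allP => x xxs; apply/(sat_Max _ (xsz _ xxs))/h.
elim: xs {zxs xsz} => //= x xs <-; rewrite expnS.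
by rewrite digit_last //; have := num_lt (map e xs); rewrite size_map.
Qed.

Lemma sat_Zero e r xs : spare \notin xs ->
  sat e (Zero r xs) <-> r * N ^ size xs + num (map e xs) == 0.
Proof.
move=> /(sat_Mins e) zxs; rewrite /Zero addn_eq0 muln_eq0.
have N0 : 0 < N := leq_ltn_trans (leq0n _) (rk_lt (e 0)).
have /gtn_eqF-> : 0 < N ^ size xs by rewrite expn_gt0 N0.
rewrite orbF.
by case: eqP => //= _; split=> // -[].
Qed.

Lemma sat_Last e r xs : r < D -> spare \notin xs ->
  sat e (Last r xs) <-> (r * N ^ size xs + num (map e xs)).+1 == D * N ^ size xs.
Proof.
move=> rD /(sat_Maxs e) zxs; rewrite /Last; have [->|rd] := eqVneq r d.
  by rewrite -addnS mulSnr eqn_add2l.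
have rd' : r < d by rewrite ltn_neqAle rd -ltnS.
have := num_lt (map e xs); rewrite size_map => vlt.
split=> [[]//|/eqP]; suff : (r * N ^ size xs + num (map e xs)).+1 < D * N ^ size xs.
  by move=> + eqD; rewrite eqD ltnn.
apply: (@leq_ltn_trans (r.+1 * N ^ size xs)); first by rewrite mulSnr -addnS leq_add2l.
by rewrite ltn_pmul2r // (leq_ltn_trans _ vlt).
Qed.

Lemma sat_Low e r xs : 0 < size xs -> spare \notin xs ->
  sat e (Low r xs) <-> r * N ^ size xs + num (map e xs) < N.-1.
Proof.
case: xs => [//|x xs] _; rewrite inE negb_or eq_sym => /andP[xz zxs].
have N0 : 0 < N := leq_ltn_trans (leq0n _) (rk_lt (e x)).
have -> : sat e (Low r (x :: xs)) <-> ~ sat e (Max x) /\ sat e (Zero r xs) by [].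
rewrite (sat_Max _ xz) (sat_Zero _ _ zxs) /= expnS.
have -> : r * (N * N ^ size xs) + (rk (e x) + N * num (map e xs)) =
  rk (e x) + N * (r * N ^ size xs + num (map e xs)) by lia.
rewrite digit_low //; split=> [[/negP-> ->]//|/andP[/negP]]; by split.
Qed.

Lemma size_tvars : size tvars = k. Proof. exact: size_iota. Qed.
Lemma size_pvars : size pvars = k. Proof. exact: size_iota. Qed.

Lemma represents_Flags r s c : r < D -> s < D ->
  represents r s (Flags r s c) (fun T P => color_flags c = flags_at N L T P).
Proof.
move=> rD sD e; rewrite /Flags /flags_at.
have zt : spare \notin tvars by rewrite tvarsP /spare; lia.
have zp : spare \notin pvars by rewrite pvarsP /spare; lia.
have := (sat_Zero e r zt, sat_Zero e s zp); rewrite size_tvars size_pvars.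
have := (sat_Last e rD zt, sat_Last e sD zp); rewrite size_tvars size_pvars.
have := sat_Low e r _ zt; rewrite size_tvars => /(_ k_gt0) h2 [h3 h5] [h1 h4].
case: (color_flags c) => [[[[b1 b2] b3] b4] b5] /=.
move: (sat_Lit b1 h1) (sat_Lit b2 h2) (sat_Lit b3 h3) (sat_Lit b4 h4) (sat_Lit b5 h5).
rewrite /tnum /pnum => -> -> -> -> ->.
by split=> [[-> [-> [-> [-> ->]]]] //|[]].
Qed.

Definition local_constraints T P :=
  (exists2 c, color_ok c & lab c T P) /\
  (forall c, lab c T P ->
    [/\ color_flags c = flags_at N L T P,
        T.+1 < L -> forall c', ~~ vert c c' -> ~ lab c' T.+1 P &
        P.+1 < L -> forall c', ~~ horiz c c' -> ~ lab c' T P.+1]).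

Lemma represents_Point r s : r < D -> s < D ->
  represents r s (Point r s)
    (fun T P => T < L -> P < L -> local_constraints T P).
Proof.
move=> rD sD e; have [tM pM] := (tnum_lt e, pnum_lt e).
have lt_L a b : b < M -> (a * M + b < L) = (a < D).
  by move=> bM; rewrite -ltn_divLR ?divnMDl ?(divn_small bM) ?addn0; lia.
rewrite /local_constraints !lt_L // rD sD.
have tL : r * M + tnum e < L by rewrite lt_L.
have pL : s * M + pnum e < L by rewrite lt_L.
rewrite sat_And sat_ExIn sat_AllIn.
have ok_iff : (exists2 c, c \in enum (@color_ok K) & sat e (Lab r s c)) <->
    exists2 c, color_ok c & lab c (r * M + tnum e) (s * M + pnum e).
  by split=> -[c cP /represents_Lab cl]; exists c; rewrite ?mem_enum // in cP *.
rewrite ok_iff.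
have t_iff c := represents_Inc_t
  (@represents_NoLab (predC (vert c)) r s) (@represents_NoLab (predC (vert c)) r.+1 s) e.
have p_iff c := represents_Inc_p
  (@represents_NoLab (predC (horiz c)) r s) (@represents_NoLab (predC (horiz c)) r s.+1) e.
have cons_iff c : sat e (Imp (Lab r s c)
    (And (Flags r s c)
    (And (Inc tvars (NoLab (predC (vert c)) r s) (NoLab (predC (vert c)) r.+1 s))
         (Inc pvars (NoLab (predC (horiz c)) r s)
                    (NoLab (predC (horiz c)) r s.+1))))) <->
   (lab c (r * M + tnum e) (s * M + pnum e) ->
    [/\ color_flags c = flags_at N L (r * M + tnum e) (s * M + pnum e),
        (r * M + tnum e).+1 < L -> forall c', ~~ vert c c' ->
          ~ lab c' (r * M + tnum e).+1 (s * M + pnum e) &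
        (s * M + pnum e).+1 < L -> forall c', ~~ horiz c c' ->
          ~ lab c' (r * M + tnum e) (s * M + pnum e).+1]).
  rewrite sat_Imp represents_Lab; split=> h /h.
    by move=> [/(represents_Flags _ rD sD) fl [/t_iff v /p_iff w]]; split; auto.
  move=> [fl v w]; split; first exact/(represents_Flags _ rD sD).
  by split; [apply/t_iff|apply/p_iff]; auto.
split=> [[ok h] _ _|/(_ isT isT)[ok h]]; split=> // c.
  by apply/cons_iff/h; rewrite mem_enum.
by move=> _; apply/cons_iff/h.
Qed.

(** Every point of the square is named by some r, s and assignment, by division by [N ^ k] and
    surjectivity of the digit expansion. *)
Lemma sat_Matrix : (forall e, sat e Matrix) <->
  forall T P, T < L -> P < L -> local_constraints T P.
Proof.
split=> [h T P TL PL|h e]; last first.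
  split; first exact: sat_Order.
  apply/sat_AllIn => r; rewrite mem_iota => rD.
  apply/sat_AllIn => s; rewrite mem_iota => sD.
  by apply/represents_Point => //; apply: h.
have M0 : 0 < M by rewrite lt0n; apply: contraTneq TL => ->; rewrite muln0.
have rD : T %/ M < D by rewrite ltn_divLR.
have sD : P %/ M < D by rewrite ltn_divLR.
have [u su uT] := num_surj (ltn_pmod T M0).
have [v sv vP] := num_surj (ltn_pmod P M0).
have [x _] : exists x : U, True.
  by case: u su {uT} => [k0|x ? _]; [move: k_gt0; rewrite -k0|exists x].
(* The time digits come before the position digits; the spare variable gets the default x. *)
pose e i := nth x (u ++ v) i.
have et : tnum e = T %% M.
  rewrite /tnum -uT; congr num; rewrite -[RHS](@take_size_cat _ k u v) //.
  rewrite /e map_nth_iota0 // size_cat; lia.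
have ep : pnum e = P %% M.
  rewrite /pnum -vP; congr num; rewrite -[RHS](@drop_size_cat _ k u v) //.
  by rewrite /e map_nth_iota ?size_cat ?su ?sv ?addKn // take_oversize // size_drop size_cat; lia.
have /sat_And[_ /sat_AllIn hr] := h e.
have /sat_AllIn hs : sat e (AllIn (iota 0 D) (Point (T %/ M))).
  by apply: hr; rewrite mem_iota.
have /(represents_Point rD sD) : sat e (Point (T %/ M) (P %/ M)).
  by apply: hs; rewrite mem_iota.
by rewrite et ep -!divn_eq; apply.
Qed.

End Semantics.

(** Finiteness does the work: a strict linear order on a finite universe is numbered by its ranks,
    with no gaps, so having nothing in between means having consecutive ranks. *)
Lemma Order_rank (S : structure grid_voc) :
  (forall e : nat -> universe S, sat e Order) ->
  exists rk : universe S -> nat,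
  [/\ forall x, rk x < #|universe S|, injective rk,
      forall x y : universe S,
        ([tuple x; y] \in interp S (inl true : symbol grid_voc)) = (rk x < rk y) &
      forall x y : universe S,
        ([tuple x; y] \in interp S (inl false : symbol grid_voc)) =
        (rk y == (rk x).+1)].
Proof.
move=> ordS; pose lt (x y : universe S) :=
  [tuple x; y] \in interp S (inl true : symbol grid_voc).
pose su (x y : universe S) :=
  [tuple x; y] \in interp S (inl false : symbol grid_voc).
have satLt (e : nat -> universe S) x y : sat e (Lt x y) <-> lt (e x) (e y).
  rewrite /= /lt; set t := map_tuple _ _.
  by have -> : t = [tuple e x; e y] by apply: val_inj.
have satSu (e : nat -> universe S) x y : sat e (Su x y) <-> su (e x) (e y).
  rewrite /= /su; set t := map_tuple _ _.
  by have -> : t = [tuple e x; e y] by apply: val_inj.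
have irr : irreflexive lt.
  move=> x; apply/negP => xx; have /sat_And[nxx _] := ordS (fun=> x).
  by apply: nxx; apply/satLt.
have tr : transitive lt.
  move=> y x z xy yz; pose e := nth x [:: x; y; z]; have /sat_And[_ /sat_And[/sat_Imp h _]] := ordS e.
  by apply/(satLt e 0 2)/h; split; apply/satLt.
have tot x y : [\/ x = y, lt x y | lt y x].
  have /sat_And[_ /sat_And[_ /sat_And[h _]]] := ordS (nth x [:: x; y]).
  case: h => [xy|[/satLt|/satLt]]; [exact: Or31 xy|exact: Or32|exact: Or33].
have rinj := rank_inj irr tr tot; have rlt := rank_lt irr.
exists (rank lt); split=> // x y; first exact: (lt_rank irr tr tot).
have /sat_And[_ /sat_And[_ /sat_And[_ /sat_Iff]]] := ordS (nth x [:: x; y]).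
rewrite satSu sat_And satLt /= -/(su x y) => suE.
apply/idP/eqP => [/suE[]|xy].
  rewrite (lt_rank irr tr tot) => xy nz; apply/eqP; rewrite eqn_leq xy andbT leqNgt.
  apply/negP => lt_xy; have [z zx] := rk_surj rlt rinj (ltn_trans lt_xy (rlt _)).
  by apply: nz; exists z; split; apply/satLt; rewrite /upd /= (lt_rank irr tr tot) zx.
apply/suE; split; first by rewrite (lt_rank irr tr tot) xy.
by case=> z [/satLt + /satLt]; rewrite /upd /= !(lt_rank irr tr tot) xy; lia.
Qed.

(** * The structure read off a tiling *)

Section GridStructure.
Variables (n : nat) (g : nat -> nat -> color K).

Definition grid_interp (r : symbol grid_voc) : {set (arity r).-tuple 'I_n} :=
  match r return {set (grid_arity r).-tuple 'I_n} with
  | inl true => [set u : 2.-tuple 'I_n | tnth u ord0 < tnth u ord_max]%SET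
  | inl false => [set u : 2.-tuple 'I_n | val (tnth u ord_max) == (tnth u ord0).+1]%SET
  | inr (r, s, c) =>
    [set u : (2 * k).-tuple 'I_n |
      g (r * n ^ k + digits_val val (take k u))
        (s * n ^ k + digits_val val (drop k u)) == c]%SET
  end.

Definition grid_structure : structure grid_voc := Structure grid_interp.

Lemma lab_grid c T P : T < D * n ^ k -> P < D * n ^ k ->
  lab (S := grid_structure) val c T P <-> g T P = c.
Proof.
move=> TL PL; have M0 : 0 < n ^ k.
  by rewrite lt0n; apply: contraTneq TL => ->; rewrite muln0.
have N0 : 0 < n by move: M0; rewrite expn_gt0 (gtn_eqF k_gt0) orbF.
rewrite /lab /= card_ord.
have rD : T %/ n ^ k < D by rewrite ltn_divLR.
have sD : P %/ n ^ k < D by rewrite ltn_divLR.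
split=> [[u + [uT uP]]|gc].
  by rewrite inE !inordK // uT uP -!divn_eq => /eqP.
have rk_lt (x : universe grid_structure) : val x < #|universe grid_structure|.
  by rewrite /= card_ord.
have [|u su uT] := @num_surj grid_structure val rk_lt val_inj k (T %% n ^ k).
  by rewrite /= card_ord ltn_pmod.
have [|v sv vP] := @num_surj grid_structure val rk_lt val_inj k (P %% n ^ k).
  by rewrite /= card_ord ltn_pmod.
have suv : size (u ++ v) == 2 * k by rewrite size_cat su sv addnn mul2n.
exists (Tuple suv); last by rewrite /= take_size_cat // drop_size_cat.
by rewrite inE /= take_size_cat // drop_size_cat // !inordK // uT vP -!divn_eq gc.
Qed.

End GridStructure.

Lemma Spec_Grid n : 0 < n ->
  Spec Grid n <-> exists g, tiling n (D * n ^ k) (g : nat -> nat -> color K).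
Proof.
move=> n0; split=> [[_ [S [nS /models_Alls S_Matrix]]]|[g [g_ok g_fl g_v g_h]]].
  rewrite -{n}nS in n0 *.
  have [e|rk [rlt rinj rLt rSu]] := @Order_rank S; first by have [] := S_Matrix e.
  have /(sat_Matrix rlt rinj rLt rSu) loc := S_Matrix.
  set N := #|universe S| in loc *; set L := D * N ^ k in loc *.
  have [c0 _] : exists c : color K, True.
    have L0 : 0 < L by rewrite muln_gt0 expn_gt0 n0.
    by have [[c _ _] _] := loc 0 0 L0 L0; exists c.
  have [g gP] : exists g : nat -> nat -> color K,
      forall T P, T < L -> P < L -> color_ok (g T P) /\ lab rk (g T P) T P.
    (* Choice of an admissible label at each point, with the default [c0] outside the square. *)
    have /choice[g gP] : forall TP : nat * nat, exists c : color K,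
        TP.1 < L -> TP.2 < L -> color_ok c /\ lab rk c TP.1 TP.2.
      move=> [T P]; have [/andP[TL PL]|nL] := boolP ((T < L) && (P < L)).
        by have [[c cok cl] _] := loc _ _ TL PL; exists c.
      by exists c0 => /= TL PL; rewrite TL PL in nL.
    by exists (fun T P => g (T, P)) => T P; apply: (gP (T, P)).
  exists g; split=> [T P TL PL|T P TL PL|T P TL PL|T P TL PL].
  - by have [] := gP _ _ TL PL.
  - have [_ gl] := gP _ _ TL PL.
    by have [_ /(_ _ gl)[]] := loc _ _ TL PL.
  - have [_ gl] := gP _ _ (ltnW TL) PL; have [_ gl'] := gP _ _ TL PL.
    have [_ /(_ _ gl)[_ h _]] := loc _ _ (ltnW TL) PL.
    by apply: contraPT gl' => /(h TL).
  - have [_ gl] := gP _ _ TL (ltnW PL); have [_ gl'] := gP _ _ TL PL.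
    have [_ /(_ _ gl)[_ _ h]] := loc _ _ TL (ltnW PL).
    by apply: contraPT gl' => /(h PL).
split=> //; exists (grid_structure n g); split; first exact: card_ord.
apply/models_Alls; apply/(@sat_Matrix (grid_structure n g) val) => /=.
- by move=> x; rewrite card_ord.
- exact: val_inj.
- by move=> x y; rewrite inE.
- by move=> x y; rewrite inE.
rewrite card_ord => T P TL PL; split.
  by exists (g T P); [exact: g_ok|apply/lab_grid].
move=> c /lab_grid; rewrite card_ord => /(_ TL PL) <-; split; first exact: g_fl.
- by move=> TL1 c' nv /lab_grid gc'; move: nv; rewrite -gc' ?g_v.
- by move=> PL1 c' nh /lab_grid gc'; move: nh; rewrite -gc' ?g_h.
Qed.

End Grid.

(** * Computations as tilings *)

Lemma size_BINARY N : size (BINARY N) = (trunc_log 2 N).+1.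
Proof. by rewrite size_map size_rev size_iota. Qed.

Lemma nth_BINARY b N P : P <= trunc_log 2 N ->
  nth b (BINARY N) P = odd (N %/ 2 ^ (trunc_log 2 N - P)).
Proof.
move=> PN; rewrite (nth_map 0) ?size_rev ?size_iota //.
by rewrite nth_rev size_iota // nth_iota ?subSS // ltnS leq_subr.
Qed.

Lemma eq_bits l a b : a < 2 ^ l -> b < 2 ^ l ->
  (forall i, i < l -> odd (a %/ 2 ^ i) = odd (b %/ 2 ^ i)) -> a = b.
Proof.
elim: l a b => [|l IHl] a b; first by case: a b => [|a] [|b].
rewrite expnS => al bl ab; rewrite -(odd_double_half a) -(odd_double_half b).
have := ab 0 isT; rewrite expn0 !divn1 => ->; congr (_ + _.*2).
apply: IHl; rewrite -?divn2 ?ltn_divLR // 1?mulnC // => i il.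
by have := ab i.+1 il; rewrite expnS !divnMA.
Qed.

Lemma BINARY_inj a b : 0 < a -> 0 < b -> BINARY a = BINARY b -> a = b.
Proof.
move=> a0 b0 ab; have := congr1 size ab; rewrite !size_BINARY => -[lab].
apply: (@eq_bits (trunc_log 2 a).+1); rewrite ?trunc_log_ltn //.
  by rewrite lab trunc_log_ltn.
move=> i il; have := congr1 (nth false ^~ (trunc_log 2 a - i)) ab.
by rewrite !nth_BINARY -?lab ?leq_subr // subKn.
Qed.

Lemma odd_lead N : 0 < N -> odd (N %/ 2 ^ trunc_log 2 N).
Proof.
move=> N0; have -> // : N %/ 2 ^ trunc_log 2 N = 1.
apply/eqP; rewrite eqn_leq -ltnS ltn_divLR ?expn_gt0 // -expnS trunc_log_ltn //.
by rewrite leq_divRL ?expn_gt0 // mul1n trunc_logP.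
Qed.

(** [2 ^ i %| x.+1] says that all bits of x below i are 1, that is, that the carry of the increment
    reaches bit i. *)
Lemma odd_divS i x : odd (x.+1 %/ 2 ^ i) = odd (x %/ 2 ^ i) (+) (2 ^ i %| x.+1).
Proof. by rewrite divnS ?expn_gt0 // oddD oddb addbC. Qed.

(** The carry goes past bit i when it arrives there and finds a 1; this is the local rule of the
    counter. *)
Lemma dvdn_exp2S i x : (2 ^ i.+1 %| x.+1) = odd (x %/ 2 ^ i) && (2 ^ i %| x.+1).
Proof.
have [/dvdnP[q xq]|ndv] := boolP (2 ^ i %| x.+1); last first.
  rewrite andbF; apply: contraNF ndv; apply: dvdn_trans.
  by rewrite expnS dvdn_mull.
have := odd_divS i x; rewrite xq expnS dvdn_mull // mulnK ?expn_gt0 // andbT addbT.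
by rewrite dvdn_pmul2r ?expn_gt0 // dvdn2 => ->; rewrite negbK.
Qed.

(** * Runs with idling *)

Section Runs.
Variable M : ntm.
Local Notation tape := 'I_(ntm_tapes M).+1.
Local Notation syms := {ffun tape -> ntm_symbol M}.
Local Notation moves := {ffun tape -> move}.
Implicit Types c : config M.

(* An instruction without action idles in an accepting state. *)
Definition instr : finType :=
  (ntm_state M * syms * option (ntm_state M * syms * moves))%type.

Definition legal (i : instr) : bool :=
  if i.2 is Some o then o \in ntm_trans i.1.1 i.1.2 else i.1.1 \in ntm_accept M.

Definition action (i : instr) : ntm_state M * syms * moves :=
  if i.2 is Some o then o else (i.1, [ffun=> Stay]).

Definition exec (i : instr) c : config M :=
  next_config c (action i).1.1 (action i).1.2 (action i).2.

Definition applies (i : instr) c := legal i /\ i.1 = (cfg_state c, scanned c).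

Lemma exec_idle c : exec (cfg_state c, scanned c, None) c = c.
Proof.
case: c => q tp hd; rewrite /exec /next_config /=; congr Config.
  by apply/funext => j; apply/funext => p; rewrite ffunE /=; case: eqP => // ->.
by apply/funext => j; rewrite ffunE.
Qed.

Lemma reach_rcons t c1 c2 c3 : reach t c1 c2 -> step c2 c3 -> reach t.+1 c1 c3.
Proof.
elim: t c1 => [|t IHt] c1 /=; first by move=> ->; exists c3.
by case=> c c1c cc2 c23; exists c => //; apply: IHt.
Qed.

Lemma reach_exec t c0 c i : reach t c0 c -> applies i c ->
  exists t', reach t' c0 (exec i c).
Proof.
case: i => [[q a] [[[q' b] d]|]] rc [] /= leg [eq_q eq_a]; last first.
  by exists t; rewrite eq_q eq_a exec_idle.
exists t.+1; apply: reach_rcons rc _; exists q', b, d.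
by split=> //; move: leg; rewrite /legal /= eq_q eq_a.
Qed.

(** Idling from time t on prolongs an accepting run indefinitely, so that it fills a square of any
    larger height. *)
Lemma reach_run t c0 c : reach t c0 c -> cfg_state c \in ntm_accept M ->
  exists (I : nat -> instr) (C : nat -> config M),
  [/\ C 0 = c0, forall T, applies (I T) (C T),
      forall T, C T.+1 = exec (I T) (C T) &
      forall T, t <= T -> (I T).2 = None].
Proof.
elim: t c0 => [|t IHt] c0 /=.
  move=> -> acc; exists (fun=> (cfg_state c, scanned c, None)), (fun=> c).
  by split=> // T; rewrite exec_idle.
case=> c1 [q [b [d [leg c1E]]]] /IHt{}IHt /IHt[I [C [C0 app CS idle]]].
exists (fun T => if T is T'.+1 then I T' else
  (cfg_state c0, scanned c0, Some (q, b, d))).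
exists (fun T => if T is T'.+1 then C T' else c0).
split=> // [[|T]|[|T]|[|T]] //=; first by rewrite C0 c1E.
exact: idle.
Qed.

End Runs.

(** * The tiles of a machine *)

Section Tiles.
Variable M : ntm.
Local Notation tape := 'I_(ntm_tapes M).+1.
Local Notation syms := {ffun tape -> ntm_symbol M}.

(* The label of the point (T, P): what happens at time T on the cells P of all
   the tapes.  The next three fields are the sets of the tapes whose head is at
   P, P - 1 and P + 1.  The fields from t_word on are used to check that the
   input is BINARY N: t_word is the bit P of the input, t_last tells whether it
   is the last one, t_cnt is the bit of the same weight in the binary
   representation of T + 1, and t_flip tells whether this bit is about to
   change.  The counter only runs in the low rows, those with T + 1 < N; it
   would overflow if it went on up to the last row. *)
Record tile := Tile {
  t_flags : bool * bool * bool * bool * bool;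
  t_instr : instr M;
  t_cont : syms;
  t_here : {set tape};
  t_left : {set tape};
  t_right : {set tape};
  t_word : option bool;
  t_last : bool;
  t_cnt : bool;
  t_flip : bool
}.

Definition tile_code (x : tile) :=
  (t_flags x, t_instr x, t_cont x, t_here x, t_left x, t_right x,
   (t_word x, t_last x, t_cnt x, t_flip x)).

Definition code_tile y :=
  let: (fl, i, co, h, l, r, (w, la, cn, f)) := y in
  Tile fl i co h l r w la cn f.

Lemma tile_codeK : cancel tile_code code_tile. Proof. by case. Qed.

HB.instance Definition _ := Finite.copy tile (can_type tile_codeK).

Definition input_symbol (w : option bool) (j : tape) : ntm_symbol M :=
  if j == ord0 then oapp (@ntm_bit M) (ntm_blank M) w else ntm_blank M.

(** A legal instruction without action needs an accepting state, so the clause for the last row is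
    acceptance. The counter starts at 1, with only its last bit set. In the first column, a leading
    1 and the absence of overflow will force the word to have the length of [BINARY N]. Outside the
    low rows the word must equal the counter, which holds N in row N - 1. *)
Definition tile_ok (x : tile) : bool :=
  let: (t_first, low, t_final, p_first, p_final) := t_flags x in
  [&& legal (t_instr x),
      [forall j in t_here x, t_cont x j == (t_instr x).1.2 j],
      t_first ==> [&& (t_instr x).1.1 == ntm_start M,
                      t_here x == if p_first then [set: tape]%SET else finset.set0,
                      [forall j, t_cont x j == input_symbol (t_word x) j] &
                      t_cnt x == t_last x],
      t_final ==> ((t_instr x).2 == None),
      p_first ==> [&& t_left x == finset.set0, t_word x == Some true &
                      ~~ [&& low, t_cnt x & t_flip x]],
      p_final ==> (t_right x == finset.set0) && (t_word x == None) &
      ~~ low ==> (t_word x \in [:: None; Some (t_cnt x)])].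

Definition moved (x : tile) : {set tape} :=
  let: (_, _, _, p_first, _) := t_flags x in
  [set j | match (action (t_instr x)).2 j with
           | Left => (j \in t_right x) || p_first && (j \in t_here x)
           | Stay => j \in t_here x
           | Right => j \in t_left x
           end]%SET.

Definition tile_vert (x y : tile) : bool :=
  let: (_, low, _, _, _) := t_flags x in
  [&& (t_instr y).1.1 == (action (t_instr x)).1.1,
      [forall j, t_cont y j == if j \in t_here x then (action (t_instr x)).1.2 j
                               else t_cont x j],
      t_here y == moved x,
      t_word y == t_word x &
      low && (t_word x != None) ==> (t_cnt y == t_cnt x (+) t_flip x)].

(** Sharing one instruction along the row makes heads at distant cells take part in the same
    transition. The carry runs leftwards, from the last bit, which always flips. *)
Definition tile_horiz (x y : tile) : bool :=
  let: (_, low, _, _, _) := t_flags x in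
  [&& t_instr y == t_instr x,
      t_right x == t_here y,
      t_left y == t_here x,
      (t_word x == None) ==> (t_word y == None),
      t_last x == (t_word x != None) && (t_word y == None) &
      low && (t_word x != None) ==>
        (t_flip x == t_last x || t_cnt y && t_flip y)].

Definition machine_tiles := Tiles t_flags tile_ok tile_vert tile_horiz.

Lemma moved_head (d : move) (h P : nat) :
  (move_head d h == P) =
  match d with
  | Left => (h == P.+1) || (P == 0) && (h == P)
  | Stay => h == P
  | Right => h.+1 == P
  end.
Proof. by case: d h P => [[|h]|h|h] [|P] //=; rewrite ?orbF. Qed.

Lemma init_tape (w : seq bool) j p :
  cfg_tape (init_config M w) j p =
  input_symbol (if p < size w then Some (nth false w p) else None) j.
Proof.
rewrite /input_symbol /=; case: ifP => // _; case: ltnP => [pw|wp].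
  by rewrite (nth_map false).
by rewrite nth_default ?size_map.
Qed.

(** * From an accepting run to a tiling *)

Section Completeness.
Variables (N L : nat).
Hypotheses (N0 : 0 < N) (NL : N < L).
Variables (I : nat -> instr M) (C : nat -> config M).
Hypothesis C0 : C 0 = init_config M (BINARY N).
Hypothesis I_applies : forall T, applies (I T) (C T).
Hypothesis CS : forall T, C T.+1 = exec (I T) (C T).
Hypothesis I_idle : forall T, L <= T.+1 -> (I T).2 = None.

Local Notation l := (trunc_log 2 N).

(** [minn] freezes the counter at N after the low rows, since it is compared with the input in all
    later rows. Column P has weight [2 ^ (l - P)], and T + 2 is the next value of the counter. *)
Definition run_tile T P : tile :=
  Tile (flags_at N L T P) (I T)
    [ffun j => cfg_tape (C T) j P]
    [set j | cfg_head (C T) j == P]%SET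
    [set j | (cfg_head (C T) j).+1 == P]%SET
    [set j | cfg_head (C T) j == P.+1]%SET
    (if P <= l then Some (odd (N %/ 2 ^ (l - P))) else None)
    (P == l)
    ((P <= l) && odd (minn T.+1 N %/ 2 ^ (l - P)))
    ((P <= l) && (2 ^ (l - P) %| T.+2)).

Lemma head_le T j : cfg_head (C T) j <= T.
Proof.
elim: T => [|T IHT]; first by rewrite C0.
by rewrite CS /=; case: ((action (I T)).2 j) => /=; lia.
Qed.

Lemma l_lt : l < N.
Proof. exact: leq_trans (ltn_expl _ _) (trunc_logP _ N0). Qed.

Lemma run_tiling : @tiling machine_tiles N L run_tile.
Proof.
have lN := l_lt; have Nl : N < 2 ^ l.+1 by apply: trunc_log_ltn.
split=> [T P TL PL|T P TL PL//|T P TL PL|T P TL PL].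
- have [leg iqa] := I_applies T.
  have /= iq := congr1 fst iqa; have /= ia := congr1 snd iqa.
  apply/and5P; split=> //=; last (apply/and3P; split).
  + by apply/forall_inP => j; rewrite inE => /eqP <-; rewrite ia !ffunE.
  + apply/implyP => /eqP T0; rewrite T0 in iq ia *; apply/and4P; split.
    * by rewrite iq C0.
    * apply/eqP/setP => j; rewrite inE C0 /= eq_sym.
      by case: eqP; rewrite inE.
    * apply/forallP => j; rewrite ffunE C0 init_tape size_BINARY ltnS.
      by case: leqP => // Pl; rewrite nth_BINARY.
    * rewrite (minn_idPl N0); case: (ltngtP P l) => [Pl|//|->] /=; last first.
        by rewrite subnn divn1.
      by rewrite divn_small // -{1}(expn0 2) ltn_exp2l // subn_gt0.
  + by apply/implyP => /eqP TL1; rewrite I_idle // -TL1.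
  + apply/implyP => /eqP P0; rewrite P0; apply/and3P; split.
    * by apply/eqP/setP => j; rewrite !inE.
    * by rewrite leq0n subn0 odd_lead.
    (* An overflow would make [2 ^ l.+1] divide T + 2, which is at most N in a low row. *)
    * rewrite leq0n subn0 /=; apply/negP => /andP[Tlo].
      have -> : minn T.+1 N = T.+1 by lia.
      by rewrite -dvdn_exp2S => /dvdn_leq; lia.
  + apply/implyP => /eqP PL1; apply/andP; split.
      apply/eqP/setP => j; rewrite !inE PL1; apply/negP => /eqP h.
      by have := head_le T j; lia.
    by case: leqP => //; lia.
  + apply/implyP => nlo; have -> : minn T.+1 N = N by lia.
    by case: leqP; rewrite !inE ?eqxx.
- have [_ /(congr1 fst) /= iq1] := I_applies T.+1.
  apply/and5P; split=> //=.
  + by rewrite iq1 CS.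
  + by apply/forallP => j; rewrite !ffunE CS inE /= [P == _]eq_sym eqxx.
  + apply/eqP/setP => j; rewrite !inE CS /= moved_head.
    by case: ((action (I T)).2 j) => //=; rewrite ?inE.
  + apply/implyP => /andP[lo]; case: (leqP P l) => //= Pl _.
    have -> : minn T.+1 N = T.+1 by lia.
    have -> : minn T.+2 N = T.+2 by lia.
    by rewrite odd_divS.
- apply/and5P; split=> //=; last (apply/andP; split).
  + by apply/implyP; case: (leqP P l) => // lP _; rewrite ltnNge (ltnW lP).
  + by case: (ltngtP P l).
  + apply/implyP => /andP[lo]; case: (leqP P l) => //= Pl _.
    have -> : minn T.+1 N = T.+1 by lia.
    move: Pl; rewrite leq_eqVlt => /predU1P[->|Pl].
      by rewrite eqxx subnn dvd1n.
    rewrite (ltn_eqF Pl) Pl /=.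
    have -> : l - P = (l - P.+1).+1 by lia.
    by rewrite dvdn_exp2S.
Qed.

End Completeness.

(** * From a tiling to an accepting run *)

Section Soundness.
Variables (N L : nat) (g : nat -> nat -> tile).
Hypotheses (N0 : 0 < N) (NL : N < L).
Hypothesis g_tiling : @tiling machine_tiles N L g.

Local Notation l := (trunc_log 2 N).

Lemma g_flags T P : T < L -> P < L -> t_flags (g T P) = flags_at N L T P.
Proof. by case: g_tiling => _ + _ _; apply. Qed.

Lemma g_ok T P : T < L -> P < L ->
  [/\ legal (t_instr (g T P)),
      forall j, j \in t_here (g T P) ->
        t_cont (g T P) j = (t_instr (g T P)).1.2 j,
      T = 0 -> [/\ (t_instr (g T P)).1.1 = ntm_start M,
                   t_here (g T P) = if P == 0 then [set: tape]%SET else finset.set0,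
                   forall j, t_cont (g T P) j = input_symbol (t_word (g T P)) j &
                   t_cnt (g T P) = t_last (g T P)],
      T.+1 = L -> (t_instr (g T P)).2 = None &
      [/\ P = 0 -> [/\ t_left (g T P) = finset.set0, t_word (g T P) = Some true &
                       T < N.-1 -> t_cnt (g T P) && t_flip (g T P) = false],
      P.+1 = L -> t_right (g T P) = finset.set0 /\ t_word (g T P) = None &
      N.-1 <= T -> t_word (g T P) != None -> t_word (g T P) = Some (t_cnt (g T P))]].
Proof.
move=> TL PL; have [+ _ _ _] := g_tiling; move=> /(_ T P TL PL).
rewrite [color_ok _]/= /tile_ok g_flags // /flags_at.
case/and5P=> leg /forall_inP here first final /and3P[pfirst pfinal high].
split=> //; first by move=> j /here/eqP.
- move=> /eqP T0; have /and4P[/eqP ? /eqP ? /forallP co /eqP ?] := implyP first T0.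
  by split=> // j; apply/eqP/co.
- by move/eqP/(implyP final)/eqP.
split.
- move=> /eqP P0; have /and3P[/eqP ? /eqP ? /negP ov] := implyP pfirst P0.
  by split=> // low; apply/negP; rewrite low in ov.
- by move=> /eqP /(implyP pfinal) /andP[/eqP ? /eqP ?].
- rewrite leqNgt => /(implyP high); rewrite !inE => /orP[/eqP->//|/eqP//].
Qed.

Lemma g_vert T P : T.+1 < L -> P < L ->
  [/\ (t_instr (g T.+1 P)).1.1 = (action (t_instr (g T P))).1.1,
      forall j, t_cont (g T.+1 P) j =
        if j \in t_here (g T P) then (action (t_instr (g T P))).1.2 j
        else t_cont (g T P) j,
      t_here (g T.+1 P) = moved (g T P),
      t_word (g T.+1 P) = t_word (g T P) &
      T < N.-1 -> t_word (g T P) != None ->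
        t_cnt (g T.+1 P) = t_cnt (g T P) (+) t_flip (g T P)].
Proof.
move=> TL PL; have [_ _ + _] := g_tiling; move=> /(_ T P TL PL).
rewrite [vert _ _]/= /tile_vert g_flags ?(ltnW TL) // /flags_at.
case/and5P=> /eqP ? /forallP co /eqP ? /eqP ? cnt.
split=> // [j|low w]; first exact/eqP/co.
by move: cnt; rewrite low w => /eqP.
Qed.

Lemma g_horiz T P : T < L -> P.+1 < L ->
  [/\ t_instr (g T P.+1) = t_instr (g T P),
      t_right (g T P) = t_here (g T P.+1),
      t_left (g T P.+1) = t_here (g T P),
      t_word (g T P) = None -> t_word (g T P.+1) = None &
      t_last (g T P) = (t_word (g T P) != None) && (t_word (g T P.+1) == None) /\
      (T < N.-1 -> t_word (g T P) != None ->
        t_flip (g T P) = t_last (g T P) || t_cnt (g T P.+1) && t_flip (g T P.+1))].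
Proof.
move=> TL PL; have [_ _ _ +] := g_tiling; move=> /(_ T P TL PL).
rewrite [horiz _ _]/= /tile_horiz g_flags ?(ltnW PL) // /flags_at.
case/and5P=> /eqP ? /eqP ? /eqP ? w /andP[/eqP la flip].
split=> //; first by move/eqP/(implyP w)/eqP.
by split=> // low wP; move: flip; rewrite low wP => /eqP.
Qed.

Lemma g_word T P : T < L -> P < L -> t_word (g T P) = t_word (g 0 P).
Proof.
move=> + PL; elim: T => [//|T IHT] TL.
by have [_ _ _ -> _] := g_vert TL PL; apply: IHT; apply: ltnW.
Qed.

Lemma g_instr T P : T < L -> P < L -> t_instr (g T P) = t_instr (g T 0).
Proof.
move=> TL; elim: P => [//|P IHP] PL.
by have [-> _ _ _ _] := g_horiz TL PL; apply: IHP; apply: ltnW.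
Qed.

(** n is the first column without a bit in row 0: the last column has none, and the first column has
    one. *)
Lemma word_length : exists2 n, 0 < n < L &
  forall T P, T < L -> P < L -> (t_word (g T P) != None) = (P < n).
Proof.
have L0 : 0 < L := leq_ltn_trans (leq0n _) NL.
have exn : exists n, (n < L) && (t_word (g 0 n) == None).
  exists L.-1; rewrite ltn_predL L0; have LL : L.-1 < L by rewrite ltn_predL.
  have [_ _ _ _ [_ h _]] := g_ok L0 LL.
  by have [|_ ->] := h; rewrite ?prednK.
case: (ex_minnP exn) => n /andP[nL wn] n_min; exists n.
  rewrite nL andbT lt0n; apply/eqP => n_0; move: wn; rewrite n_0.
  by have [_ _ _ _ [/(_ erefl)[_ ->]]] := g_ok L0 L0.
move=> T P TL PL; rewrite g_word //; case: ltnP => [Pn|nP].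
  by apply/negP => /eqP wP; move: Pn; rewrite ltnNge n_min // PL wP eqxx.
apply/negbTE; rewrite negbK; apply/eqP; move: nP PL; elim: P => [|P IHP].
  by rewrite leqn0 => /eqP nn _; rewrite nn in wn; apply/eqP.
rewrite leq_eqVlt => /predU1P[<-|nP] PL; first exact/eqP.
have [_ _ _ h _] := g_horiz L0 PL; rewrite h //.
by apply: IHP => //; apply: ltnW.
Qed.

(** By induction on T < N, row T of the counter holds T + 1; within a row, the flips are computed
    from the last bit leftwards. Row N - 1 then identifies the word with the bits of N on n + 1
    places, and the bounds [2 ^ n <= N < 2 ^ n.+1] give n = l. *)
Lemma word_BINARY P : P < L ->
  t_word (g 0 P) = if P <= l then Some (odd (N %/ 2 ^ (l - P))) else None.
Proof.
have L0 : 0 < L := leq_ltn_trans (leq0n _) NL.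
have [[//|n] nL w_lt] := word_length.
have lastE T P' : T < L -> P' <= n -> t_last (g T P') = (P' == n).
  move=> TL P'n; have PL : P'.+1 < L by lia.
  have [_ _ _ _ [-> _]] := g_horiz TL PL.
  rewrite w_lt ?(ltnW PL) // -[_ == None]negbK w_lt //; lia.
have wN T P' : T < L -> P' <= n -> t_word (g T P') != None.
  by move=> TL P'n; rewrite w_lt //; lia.
have flipE T : T < N.-1 -> (forall i, i <= n -> t_cnt (g T (n - i)) = odd (T.+1 %/ 2 ^ i)) ->
    forall i, i <= n -> t_flip (g T (n - i)) = (2 ^ i %| T.+2).
  move=> TN cntE; have TL : T < L by lia.
  elim=> [|i IHi] il.
    have PL : (n - 0).+1 < L by lia.
    have [_ _ _ _ [_ ->]] := g_horiz TL PL; rewrite ?wN ?leq_subr //.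
    by rewrite subn0 lastE // eqxx dvd1n.
  have PL : (n - i.+1).+1 < L by lia.
  have [_ _ _ _ [_ ->]] := g_horiz TL PL; rewrite ?wN ?leq_subr //.
  rewrite lastE ?leq_subr // (_ : (n - i.+1).+1 = n - i); last by lia.
  rewrite cntE ?IHi ?(ltnW il) // dvdn_exp2S.
  by case: eqP => //; lia.
have cntE T : T < N -> T.+1 < 2 ^ n.+1 /\
    forall i, i <= n -> t_cnt (g T (n - i)) = odd (T.+1 %/ 2 ^ i).
  elim: T => [_|T IHT TN].
    split=> [|i il]; first by rewrite -{1}(expn0 2) ltn_exp2l.
    have PL : n - i < L by lia.
    have [_ _ /(_ erefl)[_ _ _ ->] _ _] := g_ok L0 PL.
    rewrite lastE ?leq_subr //; case: i il {PL} => [|i] il.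
      by rewrite subn0 eqxx divn1.
    rewrite divn_small; first by apply/negbTE; lia.
    by rewrite -{1}(expn0 2) ltn_exp2l.
  have [T2 {}IHT] := IHT (ltnW TN); have TN1 : T < N.-1 by lia.
  have TL : T < L by lia.
  split; last first.
    move=> i il; have TL1 : T.+1 < L by lia.
    have PL : n - i < L by lia.
    have [_ _ _ _ ->] := g_vert TL1 PL; rewrite ?wN ?leq_subr //.
    by rewrite IHT ?flipE // [RHS]odd_divS.
  (* T + 2 = [2 ^ n.+1] would be a carry out of the first column, which [tile_ok] forbids in low
     rows. *)
  rewrite ltn_neqAle T2 andbT; apply/eqP => T2E.
  have [_ _ _ _ [/(_ erefl)[_ _ /(_ TN1)]]] := g_ok TL L0.
  by rewrite -(subnn n) IHT ?flipE // -dvdn_exp2S T2E dvdnn.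
have [Nlt cntN] := cntE N.-1 (etrans (ltn_predL N) N0).
rewrite prednK // in Nlt cntN.
have NL1 : N.-1 < L by lia.
have wE P' : P' <= n -> t_word (g 0 P') = Some (odd (N %/ 2 ^ (n - P'))).
  move=> P'n; have P'L : P' < L by lia.
  have [_ _ _ _ [_ _ /(_ (leqnn _) (wN _ _ NL1 P'n))]] := g_ok NL1 P'L.
  rewrite (g_word NL1 P'L) => ->; rewrite -cntN ?leq_subr // subKn //.
have ln : l = n.
  apply: trunc_log_eq; rewrite // Nlt andbT leqNgt; apply/negP => Nn.
  have [_ _ _ _ [/(_ erefl)[_ + _] _ _]] := g_ok L0 L0.
  by rewrite wE // subn0 divn_small.
rewrite ln => PL; case: leqP => [|nP]; first exact: wE.
by apply/eqP; rewrite -[_ == _]negbK w_lt // -leqNgt.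
Qed.

(** Built from the instructions of column 0 alone; the contents and heads shown by the tiles are
    then proved to agree with it. *)
Fixpoint tiled_config T : config M :=
  if T is T'.+1 then exec (t_instr (g T' 0)) (tiled_config T')
  else init_config M (BINARY N).

Local Notation C := tiled_config.

Lemma tiled_head_le T j : cfg_head (C T) j <= T.
Proof.
elim: T => [//|T IHT] /=.
by case: ((action _).2 j) => /=; lia.
Qed.

Lemma tiled_configP T : T < L ->
  cfg_state (C T) = (t_instr (g T 0)).1.1 /\
  forall P j, P < L ->
    t_cont (g T P) j = cfg_tape (C T) j P /\
    (j \in t_here (g T P)) = (cfg_head (C T) j == P).
Proof.
have L0 : 0 < L := leq_ltn_trans (leq0n _) NL.
elim: T => [_|T IHT TL].
  split=> [|P j PL].
    by have [_ _ /(_ erefl)[->]] := g_ok L0 L0.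
  have [_ _ /(_ erefl)[_ -> -> _] _ _] := g_ok L0 PL.
  split; last by rewrite eq_sym /=; case: eqP; rewrite inE.
  rewrite word_BINARY // init_tape size_BINARY ltnS.
  by case: leqP => // Pl; rewrite nth_BINARY.
have [Cq CTP] := IHT (ltnW TL).
split=> [|P j PL]; first by have [-> _ _ _ _] := g_vert TL L0.
have [_ -> -> _ _] := g_vert TL PL.
have [Cc Ch] := CTP P j PL; have TL' := ltnW TL.
rewrite g_instr // Cc Ch; split; first by rewrite /= [P == _]eq_sym.
rewrite /moved g_flags // /flags_at inE g_instr // /= moved_head Ch.
case: ((action _).2 j) => //.
- congr (_ || _); have [PL1|LP] := ltnP P.+1 L.
    by have [_ -> _ _ _] := g_horiz TL' PL1; have [_ ->] := CTP _ j PL1.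
  (* In the last column no head can arrive from column L: at time T < L every head is at T or to its
     left. *)
  have PL1 : P.+1 = L by lia.
  have [_ _ _ _ [_ /(_ PL1)[-> _] _]] := g_ok TL' PL.
  by rewrite inE; have := tiled_head_le T j; case: eqP => //; lia.
- case: P PL {Cc Ch} => [|P] PL.
    by have [_ _ _ _ [/(_ erefl)[->]]] := g_ok TL' PL; rewrite inE.
  have [_ _ -> _ _] := g_horiz TL' PL.
  by have [_ ->] := CTP _ j (ltnW PL).
Qed.

Lemma tiled_applies T : T < L -> applies (t_instr (g T 0)) (C T).
Proof.
move=> TL; have L0 : 0 < L := leq_ltn_trans (leq0n _) NL.
have [Cq CTP] := tiled_configP TL.
have [leg _ _ _ _] := g_ok TL L0; split=> //.
rewrite Cq [LHS]surjective_pairing; congr (_, _); apply/ffunP => j.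
(* The cell under the head lies in the square, and its tile compares the content with the
   instruction. *)
have hL : cfg_head (C T) j < L := leq_ltn_trans (tiled_head_le T j) TL.
have [cE hE] := CTP _ j hL; rewrite eqxx in hE.
have [_ /(_ j hE) aE _ _ _] := g_ok TL hL.
by rewrite ffunE -cE aE g_instr.
Qed.

Lemma tiling_accepts : language M (BINARY N).
Proof.
have reachC T : T <= L.-1 -> exists t, reach t (init_config M (BINARY N)) (C T).
  elim: T => [_|T IHT TL]; first by exists 0.
  have [t rt] := IHT (ltnW TL); apply: reach_exec rt _.
  by apply: tiled_applies; lia.
have [t rt] := reachC _ (leqnn _); have LL : L.-1 < L by lia.
exists t, (C L.-1) => //; have L0 : 0 < L by lia.
have [+ _ _ /(_ (prednK L0)) idle _] := g_ok LL L0.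
by rewrite /legal idle; have [-> _] := tiled_configP LL.
Qed.

End Soundness.
End Tiles.

(** * The time bound in terms of N, and the inclusion *)

Lemma accepts_bounded (M : ntm) m : exists B, forall N, N < m ->
  language M (BINARY N) -> exists2 t, t <= B & accepts_at M (BINARY N) t.
Proof.
elim: m => [|m [B BP]]; first by exists 0.
have [[t acc]|nacc] := pselect (language M (BINARY m)); last first.
  by exists B => N; rewrite ltnS leq_eqVlt => /predU1P[-> /nacc//|/BP].
exists (maxn B t) => N; rewrite ltnS leq_eqVlt => /predU1P[-> _|/BP h /h[t' tB ?]].
  by exists t; rewrite ?leq_maxr.
by exists t'; rewrite // leq_max tB.
Qed.

(** The factor is at least 2 so that [N < d.+2 * N ^ k] also for k = 1: the square must be longer
    than the N rows of the counter. *)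
Lemma accepts_polynomial (M : ntm) k : runs_in_bigO M (fun n => 2 ^ (k * n)) ->
  exists d, forall N, 0 < N -> language M (BINARY N) ->
    exists2 t, t < d.+2 * N ^ k & accepts_at M (BINARY N) t.
Proof.
move=> [C [n0 fast]]; have [B slow] := accepts_bounded M (2 ^ n0).
(* [B] bounds the times on the finitely many accepted inputs of length below [n0], to which the
   asymptotic bound does not apply. *)
exists (C * 2 ^ k + B) => N N0 acc; have Nk0 : 0 < N ^ k by rewrite expn_gt0 N0.
have [n0s|s_n0] := leqP n0 (size (BINARY N)).
  have [t tC ?] := fast _ acc n0s; exists t => //; apply: leq_ltn_trans tC _.
  (* [2 ^ (k * size (BINARY N)) <= 2 ^ k * N ^ k]: the factor [2 ^ k] goes into d *)
  rewrite size_BINARY mulnS expnD mulnC [k * _]mulnC expnM.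
  have : (2 ^ trunc_log 2 N) ^ k <= N ^ k.
    by case: (k) => [//|k']; rewrite leq_exp2r // trunc_logP.
  by move: (_ ^ k) (N ^ k) (2 ^ k) Nk0 => a b c; nia.
have [|t tB ?] := slow N _ acc; last by exists t => //; nia.
apply: (leq_trans (@trunc_log_ltn 2 N isT)); rewrite leq_exp2l //.
by rewrite -size_BINARY ltnW.
Qed.

Unset Implicit Arguments.
Local Open Scope classical_set_scope.

Theorem theorem3p2 (k : nat) (hk : 1 <= k) :
  NTIME (fun n => 2 ^ (k * n)) `<=` Spec_vars (2 * k + 1).
Proof.
move=> A [A_gt0 [M [langM /accepts_polynomial[d fast]]]].
exists _, (Grid (machine_tiles M) d.+1 hk).
have [sent vars_le] := Grid_sentence (machine_tiles M) d.+1 hk; split=> //.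
have accA N : A N -> language M (BINARY N) by move=> AN; rewrite langM; exists N.
have ltL N : 0 < N -> N < d.+2 * N ^ k.
  move=> N0; have : N ^ 1 <= N ^ k by rewrite leq_pexp2l.
  by rewrite expn1; nia.
apply/seteqP; split=> N.
  move=> AN; have N0 : 0 < N := A_gt0 _ AN; apply/Spec_Grid => //.
  have [t tL [c rc cacc]] := fast N N0 (accA _ AN).
  have [I [C [C0 app CS idle]]] := reach_run rc cacc.
  exists (run_tile N (d.+2 * N ^ k) I C).
  apply: run_tiling => //; first exact: ltL.
  by move=> T LT; apply: idle; rewrite -ltnS; apply: leq_trans LT.
move=> SN; have N0 : 0 < N by case: SN.
have [g /(tiling_accepts N0 (ltL _ N0))] := (Spec_Grid _ _ _ N0).1 SN.
rewrite langM => -[N' AN' /BINARY_inj <-//]; exact: A_gt0.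
Qed.
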